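(* Let $V$ be a real vector space, let $S$ be a (possibly uncountable) separating family of seminorms on $V$, and let $\tau$ be the locally convex topology on $V$ defined by $S$. Suppose that $(V,\tau)$ is separable, and let $\{x_j : j\in\mathbb{N}\}$ be a basis of a countable dimensional dense subspace $V_0$ of $(V,\tau)$. Let $L : S(V)\to\mathbb{R}$ be a linear functional on the symmetric algebra $S(V)$ of $V$ such that for each $j\in\mathbb{N}$ there exists a sequence $\{p_{jk}\}_{k=1}^{\infty}$ in $S(V_0)\otimes_{\mathbb{R}}\mathbb{C}$ with $$\lim_{k\to\infty} L\big(|1-(x_j-\mathrm{i})\,p_{jk}|^2\big)=0 .$$ Let $T$ be a countable subset of $S$ and let $K:=\bigcup_{\rho\in T}V'_\rho\subseteq V^*$. If there exists a $K$-representing measure for $L$ on $S(V)$, then this measure is unique (i.e. there is exactly one $K$-representing measure for $L$ on $S(V)$).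
   Context: The topology $\tau$ defined by a family $S$ of seminorms on $V$ is the coarsest vector space topology on $V$ for which all seminorms in $S$ are continuous; $S$ is separating if for each $0\neq v\in V$ there is $\rho\in S$ with $\rho(v)\neq 0$. $(V,\tau)$ is called separable if it has a dense linear subspace of countable dimension. The letter $S$ alone denotes the family of seminorms, whereas $S(V)$ denotes the symmetric algebra of $V$ over $\mathbb{R}$: the tensor algebra of $V$ modulo the ideal generated by all $v\otimes w-w\otimes v$, $v,w\in V$. If $\{x_i\}_{i\in\Omega}$ is a basis of $V$, then $S(V)$ is the polynomial ring $\mathbb{R}[x_i : i\in\Omega]$. In particular $S(V_0)=\mathbb{R}[x_j : j\in\mathbb{N}]$ is a subalgebra of $S(V)$. For $q=a+\mathrm{i}b\in S(V_0)\otimes_{\mathbb{R}}\mathbb{C}$ with $a,b\in S(V_0)$, $|q|^2:=q\overline{q}=a^2+b^2\in S(V_0)$, where $\mathrm{i}=\sqrt{-1}$. $V^*=\operatorname{Hom}(V,\mathbb{R})$ is the algebraic dual of $V$, endowed with the weak-* topology $\sigma(V^*,V)$, i.e. the weakest topology making $v^*\mapsto v^*(f)$ continuous for every $f\in V$. $V^*$ is identified with the space of unital $\mathbb{R}$-algebra homomorphisms $S(V)\to\mathbb{R}$ by identifying $\alpha$ with $\alpha|_V$. For $a\in S(V)$, $\hat a: V^*\to\mathbb{R}$ is the function $\hat a(\alpha)=\alpha(a)$. For $\rho\in S$, $V'_\rho$ is the subspace of $V^*$ consisting of all $\rho$-continuous linear functionals, i.e. those $x\in V^*$ for which there is $C\ge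 0$ with $|x(f)|\le C\rho(f)$ for all $f\in V$. Each $V'_\rho$ is a Borel subset of $V^*$. For a Borel subset $K$ of $V^*$, a $K$-representing measure for $L$ on $S(V)$ is a non-negative Radon measure $\mu$ on $V^*$ whose support is contained in $K$, in the sense that $\mu(V^*\setminus K)=0$, and such that $L(a)=\int \hat a\,d\mu$ for all $a\in S(V)$. *)

(* Defs.v *)
From HB Require Import structures.
From mathcomp Require Import all_boot all_order all_algebra.
From mathcomp Require Import all_classical all_reals all_analysis.
From mathcomp Require Import finmap.
From mathcomp Require Import ring lra.
From mathcomp.multinomials Require monalg.
Import -(notations) monalg.
Import Order.TTheory GRing.Theory Num.Theory.
Import numFieldTopology.Exports.

Set Implicit Arguments.
Unset Strict Implicit.
Unset Printing Implicit Defensive.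

Local Open Scope classical_set_scope.
Local Open Scope ring_scope.

Section IdealGen.
Variable A : nzRingType.

Definition two_sided_ideal (I : set A) : Prop :=
  [/\ I 0, forall a b, I a -> I b -> I (a + b)
    & forall x a y, I a -> I (x * a * y)].

Definition ideal_gen (G : set A) : set A :=
  [set a | forall I, two_sided_ideal I -> G `<=` I -> I a].

Lemma ideal_gen_ideal (G : set A) : two_sided_ideal (ideal_gen G).
Proof.
split=> [I [] //|a b Ia Ib I idI GI|x a y Ia I idI GI].
  by have [_ addI _] := idI; apply: addI; [exact: Ia|exact: Ib].
by have [_ _ mulI] := idI; apply: mulI; exact: Ia.
Qed.

Lemma ideal_genD (G : set A) a b :
  ideal_gen G a -> ideal_gen G b -> ideal_gen G (a + b).
Proof. by have [_ + _] := ideal_gen_ideal G; exact. Qed.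

Lemma ideal_genM (G : set A) x a y : ideal_gen G a -> ideal_gen G (x * a * y).
Proof. by have [_ _] := ideal_gen_ideal G; exact. Qed.

Lemma sub_ideal_gen (G : set A) : G `<=` ideal_gen G.
Proof. by move=> a Ga I _; exact. Qed.

Lemma ideal_gen_ker (B : nzRingType) (f : {rmorphism A -> B}) (G : set A) :
  (forall g, G g -> f g = 0) -> forall a, ideal_gen G a -> f a = 0.
Proof.
move=> Gf a /(_ [set a | f a = 0]); apply; last exact: Gf.
split=> [|x y /= fx fy|x y z /= fy]; first exact: rmorph0.
- by rewrite rmorphD fx fy addr0.
- by rewrite !rmorphM fy mulr0 mul0r.
Qed.

Record proper_rel := ProperRel {
  rel_set :> set A;
  rel_proper : ~ ideal_gen rel_set 1 }.

Definition in_ideal (G : proper_rel) : {pred A} := fun a => `[< ideal_gen G a >].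

Lemma in_idealP (G : proper_rel) a : reflect (ideal_gen G a) (a \in in_ideal G).
Proof. exact: asboolP. Qed.

Lemma in_ideal_zmod_closed (G : proper_rel) : zmod_closed (in_ideal G).
Proof.
split=> [|a b /in_idealP Ia /in_idealP Ib].
  by apply/in_idealP; have [] := ideal_gen_ideal G.
apply/in_idealP; apply: ideal_genD => //.
by rewrite -mulN1r -[_ * _]mulr1; exact: ideal_genM.
Qed.

HB.instance Definition _ (G : proper_rel) :=
  GRing.isZmodClosed.Build A (in_ideal G) (in_ideal_zmod_closed G).

End IdealGen.

Section QuotAlg.
Variables (R : comNzRingType) (A : algType R) (G : proper_rel A).
Local Open Scope quotient_scope.

Definition quotalg : Type := Quotient.quot (in_ideal G).

HB.instance Definition _ := GRing.Zmodule.on quotalg.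

Definition qproj (a : A) : quotalg := \pi_(Quotient.quot (in_ideal G)) a.
Definition qrepr (q : quotalg) : A := repr (q : Quotient.quot (in_ideal G)).

Lemma qreprK : cancel qrepr qproj.
Proof. by move=> q; rewrite /qproj /qrepr reprK. Qed.

Lemma qprojP a b : qproj a = qproj b <-> ideal_gen G (a - b).
Proof.
split=> [/eqP ab|/in_idealP ab].
  by apply/in_idealP; rewrite Quotient.idealrBE.
by apply/eqP; rewrite -Quotient.idealrBE.
Qed.

Lemma qprojB a b : qproj (a - b) = qproj a - qproj b.
Proof. exact: (raddfB \pi_(Quotient.quot (in_ideal G))). Qed.

Lemma qprojD a b : qproj (a + b) = qproj a + qproj b.
Proof. exact: (raddfD \pi_(Quotient.quot (in_ideal G))). Qed.

Lemma qrepr_proj a : ideal_gen G (qrepr (qproj a) - a).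
Proof. by apply/qprojP; rewrite qreprK. Qed.

Definition qone : quotalg := qproj 1.
Definition qmul : quotalg -> quotalg -> quotalg :=
  locked (fun p q => qproj (qrepr p * qrepr q)).
Definition qscale : R -> quotalg -> quotalg :=
  locked (fun c q => qproj (c *: qrepr q)).

Lemma qprojM a b : qproj (a * b) = qmul (qproj a) (qproj b).
Proof.
rewrite /qmul -lock; apply/esym/qprojP; set a' := qrepr _; set b' := qrepr _.
have -> : a' * b' - a * b = (a' - a) * b' + a * (b' - b).
  by rewrite mulrBl mulrBr addrA subrK.
apply: ideal_genD; [rewrite -[_ * _]mul1r mulrA|rewrite -[_ * _]mulr1];
  exact: (ideal_genM _ _ (qrepr_proj _)).
Qed.

Lemma qprojZ c a : qproj (c *: a) = qscale c (qproj a).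
Proof.
rewrite /qscale -lock; apply/esym/qprojP; rewrite -scalerBr -[_ - _]mul1r scalerAl -[_ * _]mulr1.
exact: (ideal_genM _ _ (qrepr_proj _)).
Qed.

Lemma qmulA : associative qmul.
Proof.
by move=> x y z; rewrite -[x]qreprK -[y]qreprK -[z]qreprK -!qprojM mulrA.
Qed.

Lemma qmul1 : left_id qone qmul.
Proof. by move=> x; rewrite -[x]qreprK -qprojM mul1r. Qed.

Lemma qmulr1 : right_id qone qmul.
Proof. by move=> x; rewrite -[x]qreprK -qprojM mulr1. Qed.

Lemma qmulDl : left_distributive qmul +%R.
Proof.
move=> x y z; rewrite -[x]qreprK -[y]qreprK -[z]qreprK.
by rewrite -qprojD -!qprojM -qprojD mulrDl.
Qed.

Lemma qmulDr : right_distributive qmul +%R.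
Proof.
move=> x y z; rewrite -[x]qreprK -[y]qreprK -[z]qreprK.
by rewrite -qprojD -!qprojM -qprojD mulrDr.
Qed.

Lemma qone_neq0 : qone != 0.
Proof.
apply/eqP => /esym; rewrite -[0](subrr (qproj 0)) -qprojB subrr => /esym/qprojP.
by rewrite subr0; exact: rel_proper.
Qed.

HB.instance Definition _ := GRing.Zmodule_isNzRing.Build quotalg
  qmulA qmul1 qmulr1 qmulDl qmulDr qone_neq0.

Lemma qscaleA a b q : qscale a (qscale b q) = qscale (a * b) q.
Proof. by rewrite -[q]qreprK -!qprojZ scalerA. Qed.

Lemma qscale1 : left_id 1 qscale.
Proof. by move=> q; rewrite -[q]qreprK -qprojZ scale1r. Qed.

Lemma qscaleDr : right_distributive qscale +%R.
Proof.
by move=> a x y; rewrite -[x]qreprK -[y]qreprK -qprojD -!qprojZ -qprojD scalerDr.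
Qed.

Lemma qscaleDl q : {morph qscale^~ q : a b / a + b}.
Proof. by move=> a b; rewrite -[q]qreprK -!qprojZ -qprojD scalerDl. Qed.

HB.instance Definition _ := GRing.Zmodule_isLmodule.Build R quotalg
  qscaleA qscale1 qscaleDr qscaleDl.

Lemma qscaleAl (c : R) (x y : quotalg) : c *: (x * y) = c *: x * y.
Proof.
have qM a b : qproj a * qproj b = qproj (a * b) by rewrite qprojM.
have qZ a : c *: qproj a = qproj (c *: a) by rewrite qprojZ.
by rewrite -[x]qreprK -[y]qreprK qM !qZ qM scalerAl.
Qed.

HB.instance Definition _ := GRing.Lmodule_isLalgebra.Build R quotalg qscaleAl.

Lemma qscaleAr (c : R) (x y : quotalg) : c *: (x * y) = x * (c *: y).
Proof.
have qM a b : qproj a * qproj b = qproj (a * b) by rewrite qprojM.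
have qZ a : c *: qproj a = qproj (c *: a) by rewrite qprojZ.
by rewrite -[x]qreprK -[y]qreprK qM !qZ qM scalerAr.
Qed.

HB.instance Definition _ := GRing.Lalgebra_isAlgebra.Build R quotalg qscaleAr.

HB.instance Definition _ := GRing.isZmodMorphism.Build A quotalg qproj qprojB.
HB.instance Definition _ := GRing.isMonoidMorphism.Build A quotalg qproj
  (erefl, qprojM).
HB.instance Definition _ := GRing.isScalable.Build R A quotalg *:%R qproj qprojZ.

Section Lift.
Variables (f : {lrmorphism A -> R | *%R}) (fG : forall g, rel_set G g -> f g = 0).

Definition quot_lift of (forall g, rel_set G g -> f g = 0) : quotalg -> R :=
  fun q => f (qrepr q).

Lemma quot_liftE a : quot_lift fG (qproj a) = f a.
Proof.
apply/eqP; rewrite /quot_lift -subr_eq0 -rmorphB; apply/eqP.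
exact: (ideal_gen_ker fG (qrepr_proj a)).
Qed.

Lemma quot_liftB : zmod_morphism (quot_lift fG).
Proof.
move=> x y; rewrite -[x]qreprK -[y]qreprK -[_ - _]qprojB !quot_liftE.
exact: rmorphB.
Qed.

Lemma quot_liftM : monoid_morphism (quot_lift fG).
Proof.
split=> [|x y]; first by rewrite -[1]/(qproj 1) quot_liftE rmorph1.
rewrite -[x]qreprK -[y]qreprK -[_ * _]qprojM !quot_liftE.
exact: rmorphM.
Qed.

Lemma quot_liftZ : scalable_for *%R (quot_lift fG).
Proof.
move=> c x; rewrite -[x]qreprK -[_ *: _]qprojZ !quot_liftE.
exact: linearZ.
Qed.

HB.instance Definition _ :=
  GRing.isZmodMorphism.Build quotalg R (quot_lift fG) quot_liftB.
HB.instance Definition _ :=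
  GRing.isMonoidMorphism.Build quotalg R (quot_lift fG) quot_liftM.
HB.instance Definition _ :=
  GRing.isScalable.Build R quotalg R *%R (quot_lift fG) quot_liftZ.

End Lift.
End QuotAlg.

Section Subalgebra.
Variables (R : comNzRingType) (A : lalgType R).

Definition is_subalgebra (B : set A) : Prop :=
  [/\ B 1, forall (c : R) a b, B a -> B b -> B (c *: a + b)
    & forall a b, B a -> B b -> B (a * b)].

Definition subalgebra_gen (X : set A) : set A :=
  [set a | forall B, is_subalgebra B -> X `<=` B -> B a].

Lemma subalgebra0 (B : set A) : is_subalgebra B -> B 0.
Proof. by case=> B1 BL _; rewrite -(addNr 1) -scaleN1r; exact: BL. Qed.

Lemma subalgebraZ (B : set A) c a : is_subalgebra B -> B a -> B (c *: a).
Proof.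
by move=> sB Ba; rewrite -[_ *: _]addr0; case: (sB) => _ + _; apply;
  last exact: subalgebra0.
Qed.

End Subalgebra.

Section TensorAlgebra.
Variables (R : comNzRingType) (V : lmodType R).

(* The tensor algebra of V is the free associative algebra on the underlying set
   of V (finite combinations of words in V) modulo the two-sided ideal making
   [v |-> word v] linear. *)
Definition freealg : Type := malg (fmonom V) R.

HB.instance Definition _ := GRing.Lalgebra.on freealg.

Lemma freealg_scaleAr (c : R) (g h : freealg) : c *: (g * h) = g * (c *: h).
Proof.
rewrite [LHS](scaler_sumr c) [RHS](fgmullw (fsubset_refl _) (msuppZ_le c h)).
apply: eq_bigr => k _; rewrite scaler_sumr; apply: eq_bigr => l _.
by rewrite -mul_malgC [LHS]fgmulUU [mul _ _]mul1m mcoeffZ mulrCA.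
Qed.

HB.instance Definition _ :=
  GRing.Lalgebra_isAlgebra.Build R freealg freealg_scaleAr.

Definition fgen (v : V) : freealg := mkmalgU (fmu v) 1.

Definition linear_rel : set freealg :=
  [set g | exists u v, g = fgen (u + v) - (fgen u + fgen v)] `|`
  [set g | exists c v, g = fgen (c *: v) - c *: fgen v].

Lemma freealg_gen (B : set freealg) :
  is_subalgebra B -> (forall v, B (fgen v)) -> forall g, B g.
Proof.
move=> sB Bgen g; have [B1 BL BM] := sB.
have Bw (s : seq V) : B (mkmalgU (FMonom s) 1).
  elim: s => [|v s IHs]; first by rewrite -fmoneE.
  have -> : mkmalgU (FMonom (v :: s)) 1 = fgen v * mkmalgU (FMonom s) 1.
    by rewrite [RHS]fgmulUU mulr1 /= [mul _ _]fmmulE fmuE.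
  exact: BM.
rewrite [g]monalgE; elim/big_rec: _ => [|k h _ Bh]; first exact: subalgebra0.
have -> : mkmalgU k (mcoeff k g) = mcoeff k g *: mkmalgU k 1.
  by rewrite -mul_malgC [RHS]fgmulUU mulr1 mul1m.
by apply: BL => //; rewrite -[k]fmK.
Qed.

Definition word_eval (x : {scalar V}) (w : fmonom V) : R := \prod_(v <- w) x v.

Lemma word_eval_mmorphism x : mmorphism (word_eval x).
Proof.
by split=> [u v|]; rewrite /word_eval ?fm1 ?big_nil // fmM big_cat.
Qed.

HB.instance Definition _ x :=
  monalg.isMultiplicative.Build (fmonom V) R (word_eval x)
    (word_eval_mmorphism x).

Definition free_eval (x : {scalar V}) : freealg -> R := mmap idfun (word_eval x).

HB.instance Definition _ x := GRing.LRMorphism.copy (free_eval x)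
  (mmap idfun (word_eval x) : {lrmorphism freealg -> R | *%R}).

Lemma free_eval_gen x v : free_eval x (fgen v) = x v.
Proof. by rewrite /free_eval /fgen mmapU /= mul1r /word_eval fmU big_seq1. Qed.

Lemma free_eval_linear_rel x g : linear_rel g -> free_eval x g = 0.
Proof.
case=> [[u [v ->]]|[c [v ->]]].
  by rewrite rmorphB rmorphD /= !free_eval_gen linearD subrr.
by rewrite rmorphB /= (scalarZ (free_eval x)) /= !free_eval_gen scalarZ subrr.
Qed.

Lemma linear_rel_proper : ~ ideal_gen linear_rel 1.
Proof.
pose x0 : {scalar V} := \0%R.
move=> /(ideal_gen_ker (f := free_eval x0) (@free_eval_linear_rel x0)) /eqP.
by rewrite rmorph1 oner_eq0.
Qed.

Definition tensor_rel := ProperRel linear_rel_proper.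
Definition tensor_alg : algType R := quotalg tensor_rel.
Definition tgen (v : V) : tensor_alg := qproj _ (fgen v).

Lemma tgen_linear : linear tgen.
Proof.
have tD u v : tgen (u + v) = tgen u + tgen v.
  apply/eqP; rewrite -subr_eq0 /tgen -rmorphD -rmorphB /=; apply/eqP.
  rewrite -(rmorph0 (qproj tensor_rel)); apply/qprojP; rewrite subr0.
  by apply: sub_ideal_gen; left; exists u, v.
have tZ c v : tgen (c *: v) = c *: tgen v.
  apply/eqP; rewrite -subr_eq0 /tgen -linearZ -rmorphB /=; apply/eqP.
  rewrite -(rmorph0 (qproj tensor_rel)); apply/qprojP; rewrite subr0.
  by apply: sub_ideal_gen; right; exists c, v.
by move=> c u v; rewrite tD tZ.
Qed.

Definition tensor_eval (x : {scalar V}) : tensor_alg -> R :=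
  quot_lift (G := tensor_rel) (f := free_eval x) (@free_eval_linear_rel x).

HB.instance Definition _ x := GRing.LRMorphism.copy (tensor_eval x)
  (quot_lift (G := tensor_rel) (f := free_eval x) (@free_eval_linear_rel x)).

Lemma tensor_eval_gen x v : tensor_eval x (tgen v) = x v.
Proof. by rewrite /tensor_eval quot_liftE /= free_eval_gen. Qed.

Definition commutator_rel : set tensor_alg :=
  [set t | exists v w, t = tgen v * tgen w - tgen w * tgen v].

Lemma tensor_eval_commutator_rel x t : commutator_rel t -> tensor_eval x t = 0.
Proof.
by move=> [v [w ->]]; rewrite rmorphB !rmorphM /= mulrC subrr.
Qed.

Lemma commutator_rel_proper : ~ ideal_gen commutator_rel 1.
Proof.
pose x0 : {scalar V} := \0%R.
move=> /(ideal_gen_ker (f := tensor_eval x0) (@tensor_eval_commutator_rel x0)) /eqP.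
by rewrite rmorph1 oner_eq0.
Qed.

Definition sym_rel := ProperRel commutator_rel_proper.
(* Tensor algebra modulo the ideal generated by all v (x) w - w (x) v. *)
Definition Sym : Type := quotalg sym_rel.
HB.instance Definition _ := GRing.Algebra.on Sym.

Definition sgen (v : V) : Sym := qproj _ (tgen v).

(* The unital algebra homomorphism on [Sym] extending the linear functional [x],
   see [sym_eval_gen] and [sym_eval_uniq]. *)
Definition sym_eval (x : {scalar V}) : Sym -> R :=
  quot_lift (G := sym_rel) (f := tensor_eval x) (@tensor_eval_commutator_rel x).

HB.instance Definition _ x := GRing.LRMorphism.copy (sym_eval x)
  (quot_lift (G := sym_rel) (f := tensor_eval x) (@tensor_eval_commutator_rel x)).

Lemma sym_eval_gen x v : sym_eval x (sgen v) = x v.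
Proof. by rewrite /sym_eval quot_liftE /= tensor_eval_gen. Qed.


Lemma sgen_linear : linear sgen.
Proof. by move=> c u v; rewrite /sgen tgen_linear linearP. Qed.

HB.instance Definition _ := GRing.isLinear.Build R V Sym *:%R sgen sgen_linear.

Lemma Sym_gen (B : set Sym) :
  is_subalgebra B -> (forall v, B (sgen v)) -> forall a, B a.
Proof.
move=> [B1 BL BM] Bgen a; rewrite -[a]qreprK -[qrepr a]qreprK.
apply: (@freealg_gen [set g | B (qproj sym_rel (qproj tensor_rel g))]) => //.
split=> [|c g h /= Bg Bh|g h /= Bg Bh].
- by rewrite /= !rmorph1.
- by rewrite !linearP; exact: BL.
- by rewrite !rmorphM; exact: BM.
Qed.

(* The subalgebra S(V0) of S(V). *)
Definition sym_sub (V0 : set V) : set Sym := subalgebra_gen (sgen @` V0).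

Lemma sgenC v w : sgen v * sgen w = sgen w * sgen v.
Proof.
have sub : commutator_rel (tgen v * tgen w - tgen w * tgen v) by exists v, w.
have /qprojP := @sub_ideal_gen _ sym_rel _ sub.
by rewrite !qprojM.
Qed.

Lemma Sym_mulC : @commutative Sym Sym *%R.
Proof.
have centr_subalg (b : Sym) : is_subalgebra [set a | a * b = b * a].
  split=> [|c u v /= ub vb|u v /= ub vb]; first by rewrite /= mul1r mulr1.
  - by rewrite mulrDl mulrDr -scalerAl -scalerAr ub vb.
  - by rewrite -mulrA vb mulrA ub mulrA.
move=> a b; apply: (Sym_gen (centr_subalg b)) => v /=; apply/esym.
by apply: (Sym_gen (centr_subalg (sgen v))) => w /=; exact: sgenC.
Qed.

HB.instance Definition _ := GRing.PzRing_hasCommutativeMul.Build Sym Sym_mulC.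

Lemma sym_eval_uniq (f : {lrmorphism Sym -> R | *%R}) (x : {scalar V}) :
  (forall v, f (sgen v) = x v) -> f =1 sym_eval x.
Proof.
move=> fx; apply: (@Sym_gen [set a | f a = sym_eval x a]) => [|v /=]; last first.
  by rewrite fx sym_eval_gen.
split=> [|c a b /= fa fb|a b /= fa fb]; first by rewrite /= !rmorph1.
- by rewrite !linearP /= fa fb.
- by rewrite !rmorphM /= fa fb.
Qed.

End TensorAlgebra.

Section Complexification.
Variable A : comNzRingType.

(* [(a, b)] stands for [a + i b] in the tensor product of [A] with the complex
   numbers. *)
Definition complexification : Type := (A * A)%type.

HB.instance Definition _ := GRing.Zmodule.on complexification.

Implicit Types p q : complexification.

Definition cplx_one : complexification := (1, 0).
Definition cplx_mul p q : complexification :=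
  (p.1 * q.1 - p.2 * q.2, p.1 * q.2 + p.2 * q.1).

Lemma cplx_mulA : associative cplx_mul.
Proof. by move=> p q r; congr pair => /=; ring. Qed.

Lemma cplx_mulC : commutative cplx_mul.
Proof. by move=> p q; congr pair => /=; ring. Qed.

Lemma cplx_mul1 : left_id cplx_one cplx_mul.
Proof. by case=> a b; congr pair => /=; ring. Qed.

Lemma cplx_mulDl : left_distributive cplx_mul +%R.
Proof. by move=> p q r; congr pair => /=; ring. Qed.

Lemma cplx_one_neq0 : cplx_one != 0.
Proof. by rewrite xpair_eqE /= negb_and oner_eq0. Qed.

HB.instance Definition _ := GRing.Zmodule_isComNzRing.Build complexification
  cplx_mulA cplx_mulC cplx_mul1 cplx_mulDl cplx_one_neq0.

Definition of_real (a : A) : complexification := (a, 0).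
Definition imag_unit : complexification := (0, 1).
Definition cplx_conj q : complexification := (q.1, - q.2).
Definition abs_sq q : A := q.1 ^+ 2 + q.2 ^+ 2.

Lemma abs_sqE q : of_real (abs_sq q) = q * cplx_conj q.
Proof.
have -> : q * cplx_conj q = cplx_mul q (cplx_conj q) by [].
by rewrite /of_real /abs_sq /cplx_mul; congr pair => /=; ring.
Qed.

(* The image of the complexification of [B]: both real and imaginary part lie
   in [B]. *)
Definition complexified (B : set A) : set complexification :=
  [set q | B q.1 /\ B q.2].

End Complexification.

Section SeminormTopology.
Variables (R : realType) (V : lmodType R).

Definition is_seminorm (rho : V -> R) : Prop :=
  (forall u v, rho (u + v) <= rho u + rho v) /\
  (forall c v, rho (c *: v) = `|c| * rho v).

Lemma seminorm_ge0 rho v : is_seminorm rho -> 0 <= rho v.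
Proof.
case=> rhoD rhoZ; have := rhoD v (- 1 *: v).
have -> : v + -1 *: v = 0 *: v by rewrite scaleN1r subrr scale0r.
by rewrite !rhoZ normr0 normrN1 mul0r mul1r; lra.
Qed.

Definition is_separating (S : set (V -> R)) : Prop :=
  forall v, v <> 0 -> exists2 rho, S rho & rho v <> 0.

Definition topo_space (tau : Topological V) : topologicalType :=
  Topological.Pack tau.

(* Continuity of the opposite follows from that of scaling. *)
Definition vector_topology (tau : Topological V) : Prop :=
  let W := topo_space tau in
  continuous (fun z : W * W => (z.1 : V) + (z.2 : V) : W) /\
  continuous (fun z : R^o * W => (z.1 : R) *: (z.2 : V) : W).

Definition seminorms_continuous (S : set (V -> R)) (tau : Topological V) : Prop :=
  forall rho, S rho -> continuous (rho : topo_space tau -> R^o).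

(* [tau] is the coarsest vector space topology making every [rho] in [S]
   continuous; [`<=`] is inclusion of the families of open sets. *)
Definition seminorm_topology (S : set (V -> R)) (tau : Topological V) : Prop :=
  [/\ vector_topology tau, seminorms_continuous S tau
    & forall tau', vector_topology tau' -> seminorms_continuous S tau' ->
        (@open (topo_space tau) : set (set V)) `<=` @open (topo_space tau')].

Definition lin_indep (x : nat -> V) : Prop :=
  forall n (c : 'I_n -> R), \sum_(i < n) c i *: x i = 0 -> forall i, c i = 0.

Definition lin_span (x : nat -> V) : set V :=
  [set v | exists n (c : 'I_n -> R), v = \sum_(i < n) c i *: x i].

Definition is_basis_of (x : nat -> V) (V0 : set V) : Prop :=
  lin_indep x /\ lin_span x = V0.

End SeminormTopology.

Section Dual.
Variables (R : realType) (V : lmodType R).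

Definition alg_dual : Type := {scalar V}.

HB.instance Definition _ := gen_eqMixin alg_dual.
HB.instance Definition _ := gen_choiceMixin alg_dual.
HB.instance Definition _ := isPointed.Build alg_dual (\0%R : {scalar V}).

Definition dual_apply (f : V) (x : alg_dual) : R^o := (x : {scalar V}) f.

(* The weak-* topology: supremum of the topologies induced by the evaluations
   at the vectors of V. *)
HB.instance Definition _ := Topological.copy alg_dual
  (sup_topology (fun f : V => Topological.class (initial_topology (dual_apply f)))).

Definition borel_dual : Type := g_sigma_algebraType (@open alg_dual).

Definition hat (a : Sym V) (x : alg_dual) : R := sym_eval (x : {scalar V}) a.

Definition continuous_dual (rho : V -> R) : set alg_dual :=
  [set x | exists2 C : R, 0 <= C & forall f, `|dual_apply f x| <= C * rho f].

Lemma dual_apply_continuous f : continuous (dual_apply f).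
Proof.
move=> x; have /cvg_sup/(_ f) h : nbhs x --> (x : alg_dual) by exact: cvg_id.
exact: cvg_trans (cvg_app _ h) (@initial_continuous alg_dual R^o (dual_apply f) x).
Qed.

Lemma measurable_continuous_dual rho :
  is_seminorm rho -> measurable (continuous_dual rho : set borel_dual).
Proof.
move=> srho.
have -> : continuous_dual rho =
    \bigcup_n \bigcap_f [set x : alg_dual | `|dual_apply f x| <= n%:R * rho f].
  apply/seteqP; split=> x.
    case=> C C0 xC; have [n Cn] : exists n : nat, C <= n%:R.
      by exists (Num.truncn C).+1; apply/ltW/truncnS_gt.
    exists n => // f _ /=; apply: le_trans (xC f) _.
    by rewrite ler_wpM2r// seminorm_ge0.
  by case=> n _ xn; exists n%:R => // f; exact: xn.
apply: bigcup_measurable => n _.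
rewrite -[X in measurable X]setCK; apply: measurableC.
apply: sub_sigma_algebra; apply/closed_openC.
apply: closed_bigI => f _.
have cf : continuous (fun x : alg_dual => `|dual_apply f x|).
  move=> x; apply: (@continuous_comp alg_dual R^o R^o (dual_apply f) Num.norm).
    exact: dual_apply_continuous.
  exact: norm_continuous.
exact: (@preimage_closed alg_dual R _ [set r | r <= n%:R * rho f]
  (fun x _ => cf x) (@closed_le R _)).
Qed.

Local Open Scope ereal_scope.

(* Locally finite and inner regular on all Borel sets with respect to compact
   sets; compact sets are Borel since the weak-* topology is Hausdorff. *)
Definition radon_measure (mu : {measure set borel_dual -> \bar R}) : Prop :=
  (forall x : alg_dual, exists2 U : set alg_dual, open_nbhs x U & mu U < +oo) /\
  (forall B : set borel_dual, measurable B ->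
     mu B = ereal_sup [set mu C | C in [set C : set alg_dual | compact C /\ C `<=` B]]).

(* The integrability clause makes the integral condition meaningful: the library
   integral is total on extended-real functions. *)
Definition representing_measure (K : set alg_dual) (L : {scalar Sym V})
    (mu : {measure set borel_dual -> \bar R}) : Prop :=
  [/\ radon_measure mu, mu (~` K) = 0 &
      forall a : Sym V,
        mu.-integrable setT (fun x => (hat a x)%:E) /\
        \int[mu]_x (hat a x)%:E = (L a)%:E].

End Dual.

(* Main.v *)
Require Import Defs.
From mathcomp Require Import all_boot all_order all_algebra.
From mathcomp Require Import all_classical all_reals all_analysis.
From mathcomp Require Import measurable_realfun finmap.
From mathcomp Require Import ring lra.
Import Order.TTheory GRing.Theory Num.Theory.
Import numFieldTopology.Exports.

(** Let [mu] and [nu] be two representing measures for [L].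

    Write [X] for the evaluation at a basis vector [x j] of the dense subspace.
    The hypothesis on [L] says that polynomials converge to [1 / (X - i)] in
    square mean, under [mu] and [nu] alike, since the error is an integral of a
    polynomial. Consider the bounded functions [F] whose products with
    polynomials have the same integrals under [mu] and [nu]. The functions that
    preserve this class by multiplication, here called multipliers, form an
    algebra closed under bounded pointwise limits, and the Cauchy-Schwarz
    inequality makes the real and imaginary parts of [1 / (X - i)] multipliers
    (multiplier_square_mean). From those two functions one obtains a bounded
    multiplier with the sign of [X - c] for every real [c]; its sign is a
    bounded limit of polynomials in it, so the indicator of [X > c] is a
    multiplier.
    The sets whose indicator is a multiplier form a sigma-algebra on which [mu]
    and [nu] agree; call them determined.

    The evaluation at an arbitrary vector [f] is reached by density. Since [T]
    is countable, a single sequence in the dense subspace converges to [f] for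
    all seminorms of [T] simultaneously (dense_seminorms_cvg), so the
    evaluations along it converge to the evaluation at [f] at each point of
    [K]. As the complement of [K] is null for both measures, every cylinder set
    over an arbitrary vector is determined (determined_cylinder).

    Cylinders over uncountably many directions generate too few Borel sets, and
    here the Radon property enters. Finite intersections of open cylinders are
    a base of the weak-* topology, and a compact set is squeezed by inner
    regularity and compactness between determined open sets, so [mu] and [nu]
    agree on compact sets and therefore on Borel sets (inner_regular_eq). *)

Set Implicit Arguments.
Unset Strict Implicit.
Unset Printing Implicit Defensive.

Local Open Scope classical_set_scope.
Local Open Scope ring_scope.

(** * Bounded measurable functions and square-mean approximation *)

Section BoundedMeasurable.
Context d (X : measurableType d) (R : realType).
Implicit Types (F G f : X -> R) (mu : {measure set X -> \bar R}).

Definition bounded_measurable F :=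
  measurable_fun setT F /\ exists C, forall x, `|F x| <= C.

Lemma bounded_measurable_cst (c : R) : bounded_measurable (fun=> c).
Proof. by split; [exact: measurable_cst|exists `|c|]. Qed.

Lemma bounded_measurableD F G : bounded_measurable F -> bounded_measurable G ->
  bounded_measurable (fun x => F x + G x).
Proof.
move=> [mF [C FC]] [mG [D GD]]; split; first exact: measurable_funD.
by exists (C + D) => x; rewrite (le_trans (ler_normD _ _))// lerD.
Qed.

Lemma bounded_measurableM F G : bounded_measurable F -> bounded_measurable G ->
  bounded_measurable (fun x => F x * G x).
Proof.
move=> [mF [C FC]] [mG [D GD]]; split; first exact: measurable_funM.
by exists (C * D) => x; rewrite normrM ler_pM.
Qed.

Lemma bounded_measurable_indic (E : set X) :
  measurable E -> bounded_measurable (\1_E : X -> R).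
Proof.
move=> mE; split; first exact: measurable_indic.
by exists 1 => x; rewrite indicE; case: (_ \in _); rewrite ?normr1 ?normr0.
Qed.

Lemma integrable_bounded_measurableM mu F f : bounded_measurable F ->
  mu.-integrable setT (EFin \o f) ->
  mu.-integrable setT (EFin \o (fun x => F x * f x)).
Proof.
move=> [mF [C FC]] fi.
have := @integrableMr _ _ _ mu setT measurableT F (EFin \o f) mF _ fi.
apply; exists C; split; first exact: num_real.
by move=> D CD x _ /=; apply: le_trans (FC x) _; exact: ltW.
Qed.

(** The Cauchy-Schwarz inequality, in the form
    2 |b (v - a)| <= t b^2 + (v - a)^2 / t, lets the square-mean error of the
    approximation absorb the unbounded weight [b]. *)
Lemma cvg_Rintegral_square_mean mu F v b (a q : nat -> X -> R) :
  bounded_measurable F -> bounded_measurable v ->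
  mu.-integrable setT (EFin \o b) ->
  mu.-integrable setT (EFin \o (fun x => b x * b x)) ->
  (forall k, mu.-integrable setT (EFin \o (fun x => a k x * b x))) ->
  (forall k, mu.-integrable setT (EFin \o q k)) ->
  (forall k x, (a k x - v x) ^+ 2 <= q k x) ->
  \int[mu]_x q k x @[k --> \oo] --> (0 : R) ->
  \int[mu]_x (F x * (a k x * b x)) @[k --> \oo] -->
    \int[mu]_x (F x * (v x * b x)).
Proof.
move=> bF bv bi bbi abi qi avq q0.
have [_ [C FC]] := bF; set B := \int[mu]_x (b x * b x).
pose C' := Num.max C 0 + 1.
have C'0 : 0 < C' by rewrite /C' ltr_wpDl// le_max lexx orbT.
have FC' x : `|F x| <= C'.
  by rewrite (le_trans (FC x))// /C' ler_wpDr// le_max lexx.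
have B0 : 0 <= B by apply: Rintegral_ge0 => x _; rewrite -expr2 sqr_ge0.
apply/cvgrPdist_le => e e0.
(* Weighting the square of [b] by [t] makes its share of the error at most
   [e / 2]; the share of [q k] is at most [e / 2] once the integral of [q k]
   is at most [e * t / C']. *)
pose t := e / (C' * (B + 1)).
have t0 : 0 < t by rewrite /t divr_gt0// mulr_gt0// ltr_wpDl.
have vbi : mu.-integrable setT (EFin \o (fun x => v x * b x)).
  exact: integrable_bounded_measurableM.
have et0 : 0 < e * t / C' by apply: divr_gt0 => //; exact: mulr_gt0.
have := q0 => /cvgrPdist_le /(_ _ et0); apply: filterS => k.
rewrite sub0r normrN => qk.
have diffi : mu.-integrable setT (EFin \o (fun x => v x * b x - a k x * b x)).
  by apply: (@integrableB _ _ _ mu setT measurableT (EFin \o _) (EFin \o _)).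
rewrite -RintegralB//; try by exact: integrable_bounded_measurableM.
under eq_Rintegral do rewrite -mulrBr.
have Fdi := integrable_bounded_measurableM bF diffi.
apply: le_trans (le_normr_Rintegral _ _) _ => //.
have domi : mu.-integrable setT
    (EFin \o (fun x => C' * t / 2 * (b x * b x) + C' / t / 2 * q k x)).
  apply: (@integrableD _ _ _ mu setT measurableT
    (EFin \o (fun x => C' * t / 2 * (b x * b x)))
    (EFin \o (fun x => C' / t / 2 * q k x))).
    exact: (integrableZl measurableT (C' * t / 2) bbi).
  exact: (integrableZl measurableT (C' / t / 2) (qi k)).
apply: (@le_trans _ _
  (\int[mu]_x (C' * t / 2 * (b x * b x) + C' / t / 2 * q k x))).
  apply: le_Rintegral => //; first exact: (integrable_norm Fdi).
  move=> x _; rewrite normrM.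
  apply: (@le_trans _ _ (C' * `|v x * b x - a k x * b x|)).
    exact: ler_wpM2r.
  have -> : C' * t / 2 * (b x * b x) + C' / t / 2 * q k x =
    C' * ((t * (b x * b x) + q k x / t) / 2) by lra.
  rewrite ler_pM2l// -mulrBl.
  have := avq k x; set dx := a k x - v x => dq.
  rewrite -[v x - _]opprB -/dx.
  apply: (@le_trans _ _ ((t * (b x * b x) + dx ^+ 2 / t) / 2)); last first.
    by rewrite ler_pM2r ?invr_gt0// lerD2l ler_pM2r ?invr_gt0.
  rewrite normrM normrN.
  have -> : b x * b x = `|b x| ^+ 2 by rewrite real_normK ?num_real// expr2.
  rewrite -[dx ^+ 2]real_normK ?num_real//.
  set D := `|dx|; set G := `|b x|.
  rewrite ler_pdivlMr// -subr_ge0.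
  have -> : t * G ^+ 2 + D ^+ 2 / t - D * G * 2 = (t * G - D) ^+ 2 / t.
    by field; rewrite gt_eqF.
  by rewrite divr_ge0 ?sqr_ge0 ?ltW.
rewrite RintegralD//; last 2 first.
- exact: (integrableZl measurableT (C' * t / 2) bbi).
- exact: (integrableZl measurableT (C' / t / 2) (qi k)).
rewrite !RintegralZl// -/B.
have qk' : \int[mu]_x q k x <= e * t / C' by rewrite (le_trans _ qk)// ler_norm.
apply: (@le_trans _ _ (C' * t / 2 * (B + 1) + C' / t / 2 * (e * t / C'))).
  apply: lerD; last first.
    by apply: ler_wpM2l => //; do 2?apply: divr_ge0 => //; exact: ltW.
  apply: ler_wpM2l; rewrite ?lerDl//.
  by apply: divr_ge0 => //; apply: mulr_ge0; exact: ltW.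
rewrite le_eqVlt; apply/orP; left; apply/eqP.
by rewrite /t; field; rewrite !gt_eqF// ltr_wpDl.
Qed.

End BoundedMeasurable.

Lemma cvg_Rintegral_bounded d (X : measurableType d) (R : realType)
    (mu : {measure set X -> \bar R}) (G : nat -> X -> R) (g f : X -> R)
    (C : R) :
  (forall n, measurable_fun setT (G n)) -> (forall n x, `|G n x| <= C) ->
  (forall x, G n x @[n --> \oo] --> g x) ->
  mu.-integrable setT (EFin \o f) ->
  \int[mu]_x (G n x * f x) @[n --> \oo] --> \int[mu]_x (g x * f x).
Proof.
move=> mG GC Gg fi.
have mf : measurable_fun setT f.
  by apply/measurable_EFinP; exact: measurable_int fi.
have Gf n x : `|G n x * f x| <= C * `|f x| by rewrite normrM ler_wpM2r.
have [] := @dominated_convergence _ X R mu setT measurableT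
  (fun n x => (G n x * f x)%:E) (fun x => (g x * f x)%:E)
  (fun x => (C * `|f x|)%:E).
- by move=> n; apply/measurable_EFinP; exact: measurable_funM.
- apply/measurable_EFinP; apply: measurable_funM => //.
  by apply: (measurable_fun_cvg mG) => // x _; exact: Gg.
- apply/aeW => x _; apply: cvg_EFin; first exact: nearW.
  by apply: cvgM; [exact: Gg|exact: cvg_cst].
- exact: (integrableZl measurableT C (integrable_norm fi)).
- by apply/aeW => x n _; rewrite lee_fin.
move=> gfi _; rewrite -[X in _ --> X -> _]fineK; first exact: fine_cvg.
exact: (integrable_fin_num measurableT gfi).
Qed.

(** * Multipliers of the moment identities *)

Section Multipliers.
Context d (X : measurableType d) (R : realType).
Variables (mu nu : {measure set X -> \bar R}) (A : set (X -> R)).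
Hypothesis A_mul : forall a b, A a -> A b -> A (fun x => a x * b x).
Hypothesis A_mu : forall a, A a -> mu.-integrable setT (EFin \o a).
Hypothesis A_nu : forall a, A a -> nu.-integrable setT (EFin \o a).

Definition same_moments (F : X -> R) := bounded_measurable F /\
  forall a, A a -> \int[mu]_x (F x * a x) = \int[nu]_x (F x * a x).

(** Functions with the same moments under both measures need not be closed
    under products; the functions that preserve them by multiplication are. *)
Definition multiplier (G : X -> R) := bounded_measurable G /\
  forall F, same_moments F -> same_moments (fun x => G x * F x).

Lemma multiplierM G H : multiplier G -> multiplier H ->
  multiplier (fun x => G x * H x).
Proof.
move=> [bG mG] [bH mH]; split; first exact: bounded_measurableM.
move=> F sF; have := mG _ (mH _ sF).
by congr same_moments; apply/funext => x; rewrite mulrA.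
Qed.

Lemma multiplier_cst c : multiplier (fun=> c).
Proof.
split; first exact: bounded_measurable_cst.
move=> F [bF sF]; split.
  by apply: bounded_measurableM => //; exact: bounded_measurable_cst.
move=> a Aa.
have cE (m : {measure set X -> \bar R}) : m.-integrable setT (EFin \o a) ->
    \int[m]_x (c * F x * a x) = c * \int[m]_x (F x * a x).
  move=> ai; rewrite -RintegralZl//; last exact: integrable_bounded_measurableM.
  by apply: eq_Rintegral => x _; rewrite mulrA.
by rewrite !cE ?sF; [|exact: Aa|exact: A_nu|exact: A_mu].
Qed.

Lemma multiplierD G H : multiplier G -> multiplier H ->
  multiplier (fun x => G x + H x).
Proof.
move=> [bG mG] [bH mH]; split; first exact: bounded_measurableD.
move=> F sF; have [bGF sGF] := mG _ sF; have [bHF sHF] := mH _ sF; split.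
  by apply: bounded_measurableM; [exact: bounded_measurableD|case: sF].
move=> a Aa.
have DE (m : {measure set X -> \bar R}) : m.-integrable setT (EFin \o a) ->
    \int[m]_x ((G x + H x) * F x * a x) =
    \int[m]_x (G x * F x * a x) + \int[m]_x (H x * F x * a x).
  move=> ai; rewrite -RintegralD//; try exact: integrable_bounded_measurableM.
  by apply: eq_Rintegral => x _; rewrite !mulrDl.
rewrite !DE; [|exact: A_nu|exact: A_mu].
by rewrite sGF// sHF.
Qed.

(** Dominated convergence: each [F x * a x] is integrable, and it is multiplied
    by functions with a common bound. *)
Lemma multiplier_cvg (G : nat -> X -> R) g C : (forall n, multiplier (G n)) ->
  (forall n x, `|G n x| <= C) -> (forall x, G n x @[n --> \oo] --> g x) ->
  multiplier g.
Proof.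
move=> mG GC Gg.
have gC x : `|g x| <= C.
  have Ggx : `|G n x| @[n --> \oo] --> `|g x| by apply: cvg_norm; exact: Gg.
  rewrite -(cvg_lim (@Rhausdorff R) Ggx); apply: limr_le.
    by apply/cvg_ex; exists `|g x|.
  exact: nearW.
have bg : bounded_measurable g.
  split; last by exists C.
  apply: (@measurable_fun_cvg _ _ _ _ G) => [n|x _]; last exact: Gg.
  by case: (mG n) => -[].
split=> // F sF; split; first by apply: bounded_measurableM => //; case: sF.
move=> a Aa; have [bF _] := sF.
have assoc (h : X -> R) (m : {measure set X -> \bar R}) :
    \int[m]_x (h x * F x * a x) = \int[m]_x (h x * (F x * a x)).
  by apply: eq_Rintegral => x _; rewrite mulrA.
rewrite !assoc.
have mGn n : measurable_fun setT (G n) by case: (mG n) => -[].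
have cmu := cvg_Rintegral_bounded mGn GC Gg
  (integrable_bounded_measurableM bF (A_mu Aa)).
have cnu := cvg_Rintegral_bounded mGn GC Gg
  (integrable_bounded_measurableM bF (A_nu Aa)).
have munu n :
    \int[mu]_x (G n x * (F x * a x)) = \int[nu]_x (G n x * (F x * a x)).
  rewrite -!assoc.
  by have [_ mGn'] := mG n; have [_ ->] := mGn' _ sF.
move: cmu; under eq_fun do rewrite munu.
by move=> cmu; exact: (cvg_unique (@Rhausdorff R) cmu cnu).
Qed.

(** This is how functions outside [A] become multipliers: [a k * b] stays in
    [A] when [b] does, so [F] has the same integral against it under both
    measures, and the square-mean limit replaces [a k] by [v]. *)
Lemma multiplier_square_mean v (a q : nat -> X -> R) : bounded_measurable v ->
  (forall k, A (a k)) -> (forall k, A (q k)) ->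
  (forall k x, (a k x - v x) ^+ 2 <= q k x) ->
  \int[mu]_x q k x @[k --> \oo] --> (0 : R) ->
  \int[nu]_x q k x @[k --> \oo] --> (0 : R) ->
  multiplier v.
Proof.
move=> bv Aa Aq avq qmu qnu; split=> // F sF; have [bF sFE] := sF.
split=> [|b Ab]; first exact: bounded_measurableM.
have cmu := cvg_Rintegral_square_mean bF bv (A_mu Ab) (A_mu (A_mul Ab Ab))
  (fun k => A_mu (A_mul (Aa k) Ab)) (fun k => A_mu (Aq k)) avq qmu.
have cnu := cvg_Rintegral_square_mean bF bv (A_nu Ab) (A_nu (A_mul Ab Ab))
  (fun k => A_nu (A_mul (Aa k) Ab)) (fun k => A_nu (Aq k)) avq qnu.
have comm (m : {measure set X -> \bar R}) :
    \int[m]_x (v x * F x * b x) = \int[m]_x (F x * (v x * b x)).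
  by apply: eq_Rintegral => x _; rewrite (mulrC (v x)) mulrA.
rewrite !comm.
move: cmu; under eq_fun => k do rewrite (sFE _ (A_mul (Aa k) Ab)).
by move=> cmu; exact: (cvg_unique (@Rhausdorff R) cmu cnu).
Qed.

Definition multiplier_set : set (set X) :=
  [set E | measurable E /\ multiplier (\1_E)].

(** Products of indicators give intersections, and bounded pointwise limits give
    countable unions. *)
Lemma sigma_algebra_multiplier_set : sigma_algebra setT multiplier_set.
Proof.
have setC_mult E : multiplier_set E -> multiplier_set (~` E).
  move=> [mE ME]; split; first exact: measurableC.
  have -> : \1_(~` E) = (fun x => 1 + (-1) * \1_E x) :> (X -> R).
    apply/funext => x; rewrite !indicE in_setC.
    by case: (x \in E); rewrite /= ?mulr1 ?subrr ?mulr0 ?addr0.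
  apply: multiplierD; first exact: multiplier_cst.
  by apply: multiplierM => //; exact: multiplier_cst.
have set0_mult : multiplier_set set0.
  by split=> //; rewrite indic0; exact: multiplier_cst.
have setI_mult E F : multiplier_set E -> multiplier_set F ->
    multiplier_set (E `&` F).
  move=> [mE ME] [mF MF]; split; first exact: measurableI.
  by rewrite indicI; exact: multiplierM.
have setU_mult E F : multiplier_set E -> multiplier_set F ->
    multiplier_set (E `|` F).
  move=> ME MF; rewrite -[E `|` F]setCK setCU.
  by apply/setC_mult/setI_mult; exact: setC_mult.
split=> [//|E ME|E ME]; first by rewrite setTD; exact: setC_mult.
have MEn n : multiplier_set (\big[setU/set0]_(i < n) E i).
  elim: n => [|n IHn]; first by rewrite big_ord0.
  by rewrite big_ord_recr; exact: setU_mult.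
split; first by apply: bigcup_measurable => n _; case: (ME n).
apply: (@multiplier_cvg (fun n => \1_(\big[setU/set0]_(i < n) E i)) _ 1).
- by move=> n; case: (MEn n).
- by move=> n x; rewrite indicE; case: (_ \in _); rewrite ?normr1 ?normr0.
move=> x; have [[n _ Enx]|Ex] := pselect ((\bigcup_k E k) x).
  rewrite indicE mem_set; last by exists n.
  apply: cvg_near_cst; near=> m; rewrite indicE mem_set// -bigcup_mkord.
  exists n => //=; near: m; exact: nbhs_infty_gt.
rewrite indicE memNset//; apply: cvg_near_cst; apply: nearW => m.
by rewrite indicE memNset// -bigcup_mkord => -[n _ Enx]; apply: Ex; exists n.
Unshelve. all: by end_near. Qed.

Lemma multiplier_set_null E : measurable E -> mu E = 0%E -> nu E = 0%E ->
  multiplier_set E.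
Proof.
move=> mE muE nuE; split=> //; split; first exact: bounded_measurable_indic.
move=> F [bF sF]; split.
  by apply: bounded_measurableM => //; exact: bounded_measurable_indic.
have int0 (m : {measure set X -> \bar R}) a : m E = 0%E ->
    m.-integrable setT (EFin \o a) -> \int[m]_x (\1_E x * F x * a x) = 0.
  move=> mE0 ai; rewrite /Rintegral.
  have -> : (\int[m]_x (\1_E x * F x * a x)%:E =
      \int[m]_(x in E) (F x * a x)%:E)%E.
    rewrite [RHS]integral_mkcond; apply: eq_integral => x _.
    rewrite indicE patchE; case: (x \in E); first by rewrite mul1r.
    by rewrite !mul0r.
  rewrite null_set_integral//.
  apply: measurable_funTS.
  exact: measurable_int (integrable_bounded_measurableM bF ai).
by move=> a Aa; rewrite !int0//; [exact: A_nu|exact: A_mu].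
Qed.

(** Taking the constant 1 both for [F] and for the element of [A] turns the
    multiplier property of an indicator into equality of measures. *)
Lemma multiplier_set_eq E : A (fun=> 1) ->
  (forall a, A a -> \int[mu]_x a x = \int[nu]_x a x) ->
  multiplier_set E -> mu E = nu E.
Proof.
move=> A1 Aeq [mE [_ ME]].
have [|_ /(_ _ A1)] := ME (fun=> 1).
  split=> [|a Aa]; first exact: bounded_measurable_cst.
  have e (m : {measure set X -> \bar R}) : \int[m]_x (1 * a x) = \int[m]_x a x.
    by apply: eq_Rintegral => x _; rewrite mul1r.
  by rewrite !e; exact: Aeq.
have finE (m : {measure set X -> \bar R}) :
    m.-integrable setT (EFin \o (fun=> 1)) -> m E \is a fin_num.
  move=> m1; have := integrable_fin_num measurableT m1.
  rewrite /= integral_cst// mul1e => mT; rewrite ge0_fin_numE//.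
  apply: le_lt_trans (le_measure _ _ _ (@subsetT _ E)) _; rewrite ?in_setE//.
  by rewrite ltey_eq mT.
have e (m : {measure set X -> \bar R}) :
    \int[m]_x (\1_E x * 1 * 1) = fine (m E).
  rewrite /Rintegral -[E in RHS]setIT -integral_indic//; congr fine.
  by apply: eq_integral => x _; rewrite !mulr1.
rewrite !e => munu.
by rewrite -(fineK (finE _ (A_mu A1))) munu fineK// finE// A_nu.
Qed.

End Multipliers.

(** * Level sets of multipliers *)

Section Sign.
Variable R : realType.
Implicit Types t : R.

(** The iterates of this odd cubic are polynomials bounded by 1 on [-1, 1] that
    converge pointwise to the sign: its fixed points are 0, which repels, and
    1 and -1, which attract. *)
Definition sign_step t := (3 * t - t ^+ 3) / 2.

Lemma sign_stepN t : sign_step (- t) = - sign_step t.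
Proof. by rewrite /sign_step; field. Qed.

Lemma sign_step_itv t : 0 <= t <= 1 -> t <= sign_step t <= 1.
Proof.
move=> /andP[t0 t1]; rewrite /sign_step; apply/andP; split.
  rewrite -subr_ge0 (_ : _ - _ = t * (1 - t ^+ 2) / 2); last by field.
  by rewrite divr_ge0// mulr_ge0// subr_ge0 expr_le1.
rewrite -subr_ge0 (_ : _ - _ = (1 - t) ^+ 2 * (2 + t) / 2); last by field.
by rewrite divr_ge0// mulr_ge0// ?sqr_ge0// addr_ge0.
Qed.

(** Iterates starting from [s] never fall below [s], so the distance to 1
    shrinks by the fixed factor [1 - s / 2] at each step. *)
Lemma sign_step_contract s t : 0 <= s -> s <= t <= 1 ->
  1 - sign_step t <= (1 - s / 2) * (1 - t).
Proof.
move=> s0 /andP[st t1]; have t0 := le_trans s0 st.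
rewrite -subr_ge0 /sign_step.
rewrite (_ : _ - _ = (1 - t) * ((t - s) + t ^+ 2) / 2); last by field.
by rewrite divr_ge0// mulr_ge0// ?subr_ge0// addr_ge0 ?subr_ge0// sqr_ge0.
Qed.

Lemma iter_sign_step_itv n t : 0 <= t <= 1 -> t <= iter n sign_step t <= 1.
Proof.
move=> t01; elim: n => [|n /andP[tn n1]] /=.
  by case/andP: t01 => _ ->; rewrite lexx.
have t0 : 0 <= t by case/andP: t01.
have := @sign_step_itv (iter n sign_step t); rewrite n1 (le_trans t0 tn).
by move=> /(_ isT)/andP[nn ->]; rewrite (le_trans tn nn).
Qed.

Lemma iter_sign_stepN n t : iter n sign_step (- t) = - iter n sign_step t.
Proof. by elim: n => //= n ->; rewrite sign_stepN. Qed.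

Lemma normr_iter_sign_step n t : `|t| <= 1 -> `|iter n sign_step t| <= 1.
Proof.
wlog t0 : t / 0 <= t => [hw|].
  have [|/ltW t0] := leP 0 t; first exact: hw.
  move=> t1; rewrite -[t]opprK iter_sign_stepN normrN.
  by apply: hw; rewrite ?oppr_ge0// normrN.
rewrite (ger0_norm t0) => t1.
have /andP[tn n1] : t <= iter n sign_step t <= 1.
  by apply: iter_sign_step_itv; rewrite t0.
by rewrite ger0_norm// (le_trans t0).
Qed.

Lemma cvg_iter_sign_step t : `|t| <= 1 ->
  iter n sign_step t @[n --> \oo] --> Num.sg t.
Proof.
wlog t0 : t / 0 <= t => [hw|].
  have [|/ltW t0] := leP 0 t; first exact: hw.
  move=> t1; rewrite -[Num.sg t]opprK -sgrN.
  under eq_fun do rewrite -[iter _ _ _]opprK -iter_sign_stepN.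
  by apply: cvgN; apply: hw; rewrite ?oppr_ge0// normrN.
rewrite (ger0_norm t0) => t1.
move: t0; rewrite le_eqVlt => /predU1P[<-|t0].
  have it0 n : iter n sign_step 0 = 0.
    by elim: n => //= n ->; rewrite /sign_step expr0n/= mulr0 subrr mul0r.
  by rewrite sgr0; under eq_fun do rewrite it0; exact: cvg_cst.
rewrite gtr0_sg//.
have tn n : t <= iter n sign_step t <= 1.
  by apply: iter_sign_step_itv; rewrite ltW.
pose r := 1 - t / 2.
have r01 : `|r| < 1 by rewrite ltr_norml /r; apply/andP; split; lra.
have r0 : 0 <= r by rewrite /r; lra.
have bound n : 1 - iter n sign_step t <= r ^+ n.
  elim: n => [|n IHn] /=; first by rewrite expr0 lerBlDr lerDl ltW.
  have := sign_step_contract (ltW t0) (tn n); move/le_trans; apply.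
  by rewrite exprS ler_wpM2l.
have rn0 : 1 - r ^+ n @[n --> \oo] --> (1 : R).
  rewrite -[X in _ --> X]subr0.
  by apply: cvgB; [exact: cvg_cst|exact: cvg_expr].
apply: (squeeze_cvgr (f := fun n => 1 - r ^+ n) (h := fun=> 1)) => //.
  apply: nearW => n; case/andP: (tn n) => _ ->.
  by rewrite andbT lerBlDr addrC -lerBlDr.
exact: cvg_cst.
Qed.

End Sign.

Section LevelSets.
Context d (X : measurableType d) (R : realType).
Variables (mu nu : {measure set X -> \bar R}) (A : set (X -> R)).
Hypothesis A_mu : forall a, A a -> mu.-integrable setT (EFin \o a).
Hypothesis A_nu : forall a, A a -> nu.-integrable setT (EFin \o a).

(** The sign of [g] is a bounded limit of polynomials in [g], and the indicator
    of a positive number [t] is [(sg t ^+ 2 + sg t) / 2]. *)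
Lemma multiplier_set_gt0 g : multiplier mu nu A g ->
  multiplier_set mu nu A [set x | 0 < g x].
Proof.
move=> Mg; have [[mg [C gC]] _] := Mg; pose c := (`|C| + 1)^-1.
have c0 : 0 < c by rewrite invr_gt0 ltr_wpDl.
have cg x : `|c * g x| <= 1.
  rewrite normrM gtr0_norm// mulrC ler_pdivrMr ?ltr_wpDl// mul1r.
  by rewrite (le_trans (gC x))// (le_trans (ler_norm _))// lerDl.
have Mstep n : multiplier mu nu A (fun x => iter n (@sign_step R) (c * g x)).
  elim: n => [|n IHn] /=.
    by apply: multiplierM => //; exact: multiplier_cst.
  set h := fun x : X => iter _ _ _ in IHn *.
  have -> : (fun x => sign_step (iter n (@sign_step R) (c * g x))) =
      (fun x => (3/2) * h x + (- (1/2)) * (h x * (h x * h x))).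
    by apply/funext => x; rewrite /sign_step -/(h x); field.
  apply: multiplierD => //; apply: multiplierM; try exact: multiplier_cst => //.
    by [].
  by do 2?apply: multiplierM.
have Msg : multiplier mu nu A (fun x => Num.sg (g x)).
  apply: (multiplier_cvg A_mu A_nu Mstep (C := 1)).
    by move=> n x; exact: normr_iter_sign_step.
  move=> x; rewrite -[Num.sg (g x)]mul1r -(gtr0_sg c0) -sgrM.
  exact: cvg_iter_sign_step.
split.
  have -> : [set x | 0 < g x] = setT `&` g @^-1` `]0, +oo[.
    by rewrite setTI; apply/seteqP; split=> x; rewrite /= in_itv/= andbT.
  exact: mg.
have -> : \1_[set x | 0 < g x] =
    (fun x => 1/2 * (Num.sg (g x) * Num.sg (g x) + Num.sg (g x))) :> (X -> R).
  apply/funext => x; rewrite indicE; have [g0|g0|g0] := sgrP (g x).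
  - by rewrite memNset/= ?g0 ?ltxx// mulr0 addr0 mulr0.
  - by rewrite mem_set//=; field.
  - by rewrite memNset/= ?le_gtF ?ltW//; field.
apply: multiplierM; first exact: multiplier_cst.
by apply: multiplierD => //; exact: multiplierM.
Qed.

(** With [u] and [v] for the two multipliers, [v - c * u] has the sign of [f - c];
    unlike [f] itself, it is bounded and can be a multiplier. *)
Lemma measurable_multiplier_set f :
  multiplier mu nu A (fun x => 1 / (1 + f x ^+ 2)) ->
  multiplier mu nu A (fun x => f x / (1 + f x ^+ 2)) ->
  measurable_fun setT (f : g_sigma_algebraType (multiplier_set mu nu A) -> R).
Proof.
move=> Mu Mv; apply: (measurability _ (RGenOInfty.measurableE R)).
move=> _ [_ [c ->] <-]; apply: sub_sigma_algebra; rewrite setTI.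
have -> : f @^-1` `]c, +oo[ =
    [set x | 0 < f x / (1 + f x ^+ 2) + (- c) * (1 / (1 + f x ^+ 2))].
  apply/seteqP; split=> x;
    rewrite /= in_itv/= andbT mul1r -mulrDl pmulr_lgt0 ?subr_gt0//;
    by rewrite invr_gt0 ltr_wpDr// sqr_ge0.
apply: multiplier_set_gt0; apply: multiplierD => //; apply: multiplierM => //.
exact: multiplier_cst.
Qed.

End LevelSets.

(** * Radon measures that agree on a base of open sets *)

Section RadonUniqueness.
Context (X : ptopologicalType) (R : realType).
Hypothesis X_hausdorff : hausdorff_space X.
Local Notation borel := (g_sigma_algebraType (@open X)).
Implicit Types (mu nu : {measure set borel -> \bar R}) (D : set (set X)).

Definition inner_regular mu := forall B : set borel, measurable B ->
  mu B = ereal_sup [set mu C | C in [set C : set X | compact C /\ C `<=` B]].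

Lemma compact_borel (C : set X) : compact C -> measurable (C : set borel).
Proof.
move=> cC; rewrite -(setCK C); apply: (@measurableC _ borel).
by apply: sub_sigma_algebra; apply/closed_openC; exact: compact_closed.
Qed.

Lemma measure_setTC mu (B : set borel) : measurable B ->
  (mu setT = mu B + mu (~` B))%E.
Proof.
move=> mB; by rewrite -measureU ?setUv ?setICr//; exact: measurableC.
Qed.

Lemma compact_sub_base D (C U : set X) : D set0 ->
  (forall V W, D V -> D W -> D (V `|` W)) ->
  (forall (V : set X) x, open V -> V x ->
    exists W, [/\ open W, D W, W x & W `<=` V]) ->
  compact C -> open U -> C `<=` U ->
  exists W, [/\ open W, D W, C `<=` W & W `<=` U].
Proof.
move=> D0 DU Dbase; rewrite compact_cover => cC oU CU.
have [||F FD CF] := cC (set X) [set W | [/\ open W, D W & W `<=` U]] id.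
- by move=> W [].
- by move=> x /CU /(Dbase _ _ oU)[W [oW DW Wx WU]]; exists W.
exists (\bigcup_(W in [set` F]) W).
have FW W : W \in F -> [/\ open W, D W & W `<=` U] by move=> /FD /set_mem.
split=> //; last by move=> x [W /FW[_ _ +]]; exact.
  by apply: bigcup_open => W /FW[].
by rewrite bigcup_fset big_seq; apply: big_ind => // W /FW[].
Qed.

(** Inner regularity on the complement of [C] yields a compact [E] disjoint from
    [C] whose complement exceeds [C] by little measure. An open set of [D]
    lies between [C] and the complement of [E], and both measures agree on
    it. *)
Lemma compact_le_measure mu nu D (C : set X) : D set0 ->
  (forall V W, D V -> D W -> D (V `|` W)) ->
  (forall (V : set X) x, open V -> V x ->
    exists W, [/\ open W, D W, W x & W `<=` V]) ->
  (forall W, open W -> D W -> mu W = nu W) ->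
  (nu setT < +oo)%E -> inner_regular nu -> compact C -> (mu C <= nu C)%E.
Proof.
move=> D0 DU Dbase munu nuT nureg cC.
have mC := compact_borel cC.
have nufin (B : set borel) : measurable B -> nu B \is a fin_num.
  move=> mB; rewrite ge0_fin_numE//; apply: le_lt_trans nuT.
  by apply: le_measure; rewrite ?in_setE.
apply/lee_addgt0Pr => e e0.
have mCC := measurableC mC.
have supE := nureg _ mCC.
have [|_ [E [cE EC] <-]] := @ub_ereal_sup_adherent _
    [set nu K | K in [set K : set X | compact K /\ K `<=` ~` C]] _ e0.
  by rewrite -supE nufin.
rewrite -supE => nuE.
have mE := compact_borel cE.
have oE : open (~` E) by apply/closed_openC; exact: compact_closed.
have [|W [oW DW CW WE]] := compact_sub_base D0 DU Dbase cC oE.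
  by move=> x Cx Ex; exact: EC Ex Cx.
have mW : measurable (W : set borel) by exact: sub_sigma_algebra.
apply: (@le_trans _ _ (nu (~` E))).
  apply: (@le_trans _ _ (mu W)); first by apply: le_measure; rewrite ?in_setE.
  by rewrite munu//; apply: le_measure; rewrite ?in_setE//; exact: measurableC.
have := measure_setTC nu mC; rewrite (measure_setTC nu mE).
move: nuE; have mEC := measurableC mE.
rewrite -(fineK (nufin _ mC)) -(fineK (nufin _ mCC)) -(fineK (nufin _ mE)).
rewrite -(fineK (nufin _ mEC)) -!EFinB -!EFinD lte_fin lee_fin => ? [].
lra.
Qed.

Lemma inner_regular_eq mu nu D : D set0 ->
  (forall V W, D V -> D W -> D (V `|` W)) ->
  (forall (V : set X) x, open V -> V x ->
    exists W, [/\ open W, D W, W x & W `<=` V]) ->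
  (forall W, open W -> D W -> mu W = nu W) ->
  (mu setT < +oo)%E -> (nu setT < +oo)%E ->
  inner_regular mu -> inner_regular nu ->
  forall B : set borel, measurable B -> mu B = nu B.
Proof.
move=> D0 DU Dbase munu muT nuT mureg nureg B mB.
rewrite (mureg _ mB) (nureg _ mB); congr ereal_sup.
apply: eq_imagel => C [cC _]; apply/eqP; rewrite eq_le; apply/andP; split.
  exact: (compact_le_measure D0 DU Dbase munu).
by apply: (compact_le_measure D0 DU Dbase _ muT) => // W oW DW; rewrite munu.
Qed.

End RadonUniqueness.

(** * The weak-* topology of the algebraic dual *)

Section DualTopology.
Context (R : realType) (V : lmodType R).
Local Notation dual := (alg_dual V).

Lemma alg_dual_ext (x y : dual) :
  (forall f, dual_apply f x = dual_apply f y) -> x = y.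
Proof.
rewrite /dual_apply; case: x => x [[xa] [xs]]; case: y => y [[ya] [ys]] /= xy.
have exy : x = y by exact/funext.
move: xa xs; rewrite exy => xa xs.
by rewrite (Prop_irrelevance xa ya) (Prop_irrelevance xs ys).
Qed.

Lemma measurable_dual_apply f :
  measurable_fun setT (dual_apply f : borel_dual V -> R).
Proof.
apply: (measurability _ (RGenOInfty.measurableE R)).
move=> _ [_ [c ->] <-]; apply: sub_sigma_algebra; rewrite setTI.
apply: (@open_comp dual R^o) => [z _|]; first exact: dual_apply_continuous.
exact: rray_open.
Qed.

Lemma alg_dual_hausdorff : hausdorff_space dual.
Proof.
move=> x y xy; apply: alg_dual_ext => f; apply: (@Rhausdorff R).
move=> P Q Px Qy; have [z [Pz Qz]] := xy _ _
  (dual_apply_continuous Px) (dual_apply_continuous Qy).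
by exists (dual_apply f z).
Qed.

(** Basic open sets are finite intersections of preimages of open sets of reals
    under evaluations. *)
Lemma alg_dual_base (D : set (set dual)) : D setT ->
  (forall P Q, D P -> D Q -> D (P `&` Q)) ->
  (forall (f : V) (G : set R^o), open G -> D (dual_apply f @^-1` G)) ->
  forall (U : set dual) x, open U -> U x ->
    exists W, [/\ open W, D W, W x & W `<=` U].
Proof.
move=> DT DI Dcyl U x oU Ux.
have : nbhs x U by exact: open_nbhs_nbhs.
move=> [_ [[B sB <-] [W BW Wx] BU]].
have WU : W `<=` U by move=> z Wz; apply: BU; exists W.
exists W.
have [F sF FW] := sB _ BW.
have cyl E : E \in F ->
      exists (f : V) (G : set R^o), open G /\ dual_apply f @^-1` G = E.
  by move=> /sF /set_mem [f _ [G oG <-]]; exists f, G.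
rewrite -FW in Wx WU *.
split => //.
  rewrite bigcap_fset big_seq; apply: big_ind => [||E /cyl].
  - exact: openT.
  - exact: openI.
  - case=> f [G] [oG <-]; apply: open_comp => // z _.
    exact: dual_apply_continuous.
rewrite bigcap_fset big_seq; apply: big_ind => // E /cyl [f] [G] [oG <-].
exact: Dcyl.
Qed.

End DualTopology.

(** * Approximation in countably many seminorms *)

Section SeminormDensity.
Context (R : realType) (V : lmodType R).
Implicit Types (rho : V -> R).

Lemma open_seminorm_ball (tau : Topological V) rho (f : V) (e : R) :
  vector_topology tau -> continuous (rho : topo_space tau -> R^o) ->
  open ([set v : V | rho (f - v) < e] : set (topo_space tau)).
Proof.
move=> [Dc Zc] rhoc; pose W := topo_space tau.
have subc : continuous ((fun v => f - v) : W -> W).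
  move=> v.
  have -> : (fun w => f - w) = (fun w => f + (-1) *: w).
    by apply/funext => w; rewrite scaleN1r.
  have Nc : ((-1) *: (w : V) : W) @[w --> (v : W)] --> ((-1) *: v : W).
    apply: (@continuous2_cvg W R^o W W _ _ (fun=> -1) id
      (fun (c : R) (u : V) => c *: u : W) (-1) v (Zc (-1, v))).
      exact: cvg_cst.
    exact: cvg_id.
  apply: (@continuous2_cvg W W W W _ _ (fun=> f) (fun w : V => -1 *: w)
    (fun u w : V => u + w : W) f (-1 *: v) (Dc (f, -1 *: v))) => //.
  exact: cvg_cst.
apply: (@open_comp W R^o (fun v => rho (f - v)) [set r : R^o | r < e]).
  move=> v _; apply: (@continuous_comp W W R^o (fun v => f - v) rho).
    exact: subc.
  exact: rhoc.
exact: (@open_lt R).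
Qed.

Lemma dense_seminorms (S : set (V -> R)) (tau : Topological V) (V0 : set V) :
  (forall rho, S rho -> is_seminorm rho) -> seminorm_topology S tau ->
  dense (V0 : set (topo_space tau)) ->
  forall (g : nat -> V -> R) (n : nat) (f : V) (e : R), 0 < e ->
    (forall i, S (g i)) ->
    exists2 v, V0 v & forall i, (i < n)%N -> g i (f - v) < e.
Proof.
move=> Ssemi [vtau Sc _] V0d g n f e e0 gS.
have := V0d [set v | forall i, (i < n)%N -> g i (f - v) < e].
case.
- exists f => i _; have [_ gZ] := Ssemi _ (gS i).
  by rewrite subrr -(scale0r f) gZ normr0 mul0r.
- elim: n => [|n IHn].
    rewrite (_ : [set v | _] = setT); first exact: openT.
    by apply/seteqP; split.
  rewrite (_ : [set v | _] = [set v | g n (f - v) < e] `&`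
      [set v | forall i, (i < n)%N -> g i (f - v) < e]); last first.
    apply/seteqP; split=> [v vs|v [vn vs] i /=].
      by split=> [|i i_n]; apply: vs => //; exact: ltnW.
    by rewrite ltnS leq_eqVlt => /predU1P[->//|]; exact: vs.
  by apply: openI => //; apply: open_seminorm_ball => //; exact: Sc.
- by move=> v [vs V0v]; exists v.
Qed.

Lemma countable_enumeration (U : Type) (T : set U) : countable T -> T !=set0 ->
  exists g : nat -> U, T = range g.
Proof.
move=> /pfcard_geP[->|[g]]; first by case.
by move=> _; exists g; rewrite [RHS]image_eq.
Qed.

(** The approximating sequence is chosen diagonally: its [n]-th term is close to
    [f] for the first [n] seminorms of an enumeration of [T]. *)
Lemma dense_seminorms_cvg (S T : set (V -> R)) (tau : Topological V)
    (V0 : set V) :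
  (forall rho, S rho -> is_seminorm rho) -> seminorm_topology S tau ->
  dense (V0 : set (topo_space tau)) -> T `<=` S -> countable T ->
  forall f, exists2 v : nat -> V, (forall n, V0 (v n)) &
    forall rho, T rho -> rho (f - v n) @[n --> \oo] --> (0 : R).
Proof.
move=> Ssemi tauS V0d TS Tc f; have [T0|/set0P T0] := eqVneq T set0.
  have [|v [_ V0v]] := V0d setT _ openT; first by exists f.
  by exists (fun=> v) => // rho; rewrite T0.
have [g Tg] := countable_enumeration Tc T0.
have gT n : T (g n) by rewrite Tg; exists n.
have /choice[v vP] : forall n, exists v, V0 v /\
    forall i, (i < n)%N -> g i (f - v) < n.+1%:R^-1.
  move=> n; have n0 : 0 < n.+1%:R^-1 :> R by rewrite invr_gt0.
  have [v V0v vg] :=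
    dense_seminorms Ssemi tauS V0d n f n0 (fun i => TS _ (gT i)).
  by exists v.
exists v => [n|rho]; first by case: (vP n).
rewrite Tg => -[i _ <-].
apply: (squeeze_cvgr (f := fun=> 0) (h := @harmonic R)); first last.
- exact: cvg_harmonic.
- exact: cvg_cst.
near=> n; rewrite seminorm_ge0/=; last exact/Ssemi/TS/gT.
have [_ /(_ i)] := vP n; rewrite /harmonic => h; apply/ltW/h.
near: n; exact: nbhs_infty_gt.
Unshelve. all: by end_near. Qed.

End SeminormDensity.

(** * Sets determined by the moments *)

Section HatFunctions.
Context (R : realType) (V : lmodType R).

Lemma hatM (a b : Sym V) : hat (a * b) = (fun z => hat a z * hat b z).
Proof. by apply/funext => z; rewrite /hat rmorphM. Qed.

Lemma hat_abs_sq (s : V) (p : complexification (Sym V)) z :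
  hat (abs_sq (1 - (of_real (sgen s) - imag_unit (Sym V)) * p)) z =
  (1 - dual_apply s z * hat p.1 z - hat p.2 z) ^+ 2 +
  (dual_apply s z * hat p.2 z - hat p.1 z) ^+ 2.
Proof.
have -> : abs_sq (1 - (of_real (sgen s) - imag_unit (Sym V)) * p) =
    (1 - ((sgen s - 0) * p.1 - (0 - 1) * p.2)) ^+ 2 +
    (0 - ((sgen s - 0) * p.2 + (0 - 1) * p.1)) ^+ 2 by [].
have -> : (1 - ((sgen s - 0) * p.1 - (0 - 1) * p.2)) ^+ 2 +
    (0 - ((sgen s - 0) * p.2 + (0 - 1) * p.1)) ^+ 2 =
    (1 - sgen s * p.1 - p.2) ^+ 2 + (sgen s * p.2 - p.1) ^+ 2 by ring.
by rewrite /hat rmorphD !rmorphXn !rmorphB !rmorphM rmorph1 /= sym_eval_gen.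
Qed.

End HatFunctions.

Section DeterminedSets.
Context (R : realType) (V : lmodType R).
Local Notation dual := (alg_dual V).
Local Notation borel := (borel_dual V).
Variables (L : {scalar Sym V}) (K : set dual).
Variables (mu nu : {measure set borel -> \bar R}).
Hypotheses (mu_rep : representing_measure K L mu)
  (nu_rep : representing_measure K L nu).

Definition polynomial_functions : set (borel -> R) := [set hat a | a in setT].
Local Notation A := polynomial_functions.
Local Notation det := (multiplier_set mu nu A).

Lemma polynomial_functionsM a b : A a -> A b -> A (fun z => a z * b z).
Proof. by move=> [p _ <-] [q _ <-]; exists (p * q); rewrite ?hatM. Qed.

Lemma polynomial_functions_integrable (m : {measure set borel -> \bar R}) a :
  representing_measure K L m -> A a -> m.-integrable setT (EFin \o a).
Proof. by move=> [_ _ mL] [p _ <-]; case: (mL p). Qed.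

Lemma Rintegral_hat (m : {measure set borel -> \bar R}) (a : Sym V) :
  representing_measure K L m -> \int[m]_z hat a z = L a.
Proof. by move=> [_ _ mL]; rewrite /Rintegral; have [_ ->] := mL a. Qed.

Let A_mu a : A a -> mu.-integrable setT (EFin \o a).
Proof. exact: polynomial_functions_integrable. Qed.

Let A_nu a : A a -> nu.-integrable setT (EFin \o a).
Proof. exact: polynomial_functions_integrable. Qed.

Lemma determined_eq E : det E -> mu E = nu E.
Proof.
apply: (multiplier_set_eq A_mu A_nu).
  by exists 1 => //; apply/funext => z; rewrite /hat rmorph1.
by move=> _ [p _ <-]; rewrite (Rintegral_hat _ mu_rep) (Rintegral_hat _ nu_rep).
Qed.

(** The resolvent of the evaluation [X] at [s] is [1 / (X - i) = v + i u], with
    [v = X / (1 + X^2)] and [u = 1 / (1 + X^2)]. For [p = a + i b],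
    [|1 - (X - i) p|^2 = (1 + X^2) ((a - v)^2 + (b - u)^2)], so the hypothesis
    says that the polynomials [a] and [b] converge to [v] and [u] in square
    mean, for every representing measure; hence [u] and [v] are multipliers. *)
Lemma measurable_determined_dual_apply (s : V)
    (p : nat -> complexification (Sym V)) :
  (fun k => L (abs_sq (1 - (of_real (sgen s) - imag_unit (Sym V)) * p k)))
    @ \oo --> (0 : R) ->
  measurable_fun setT (dual_apply s : g_sigma_algebraType det -> R).
Proof.
move=> Lp; pose X := dual_apply s.
pose q k := hat (abs_sq (1 - (of_real (sgen s) - imag_unit (Sym V)) * p k)).
have Aq k : A (q k) by eexists.
have q0 (m : {measure set borel -> \bar R}) : representing_measure K L m ->
    \int[m]_z q k z @[k --> \oo] --> (0 : R).
  by move=> mrep; under eq_fun do rewrite (Rintegral_hat _ mrep).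
have X1 z : 0 < 1 + X z ^+ 2 by rewrite ltr_wpDr// sqr_ge0.
have q_err k z : q k z = (1 + X z ^+ 2) *
    ((hat (p k).1 z - X z / (1 + X z ^+ 2)) ^+ 2 +
     (hat (p k).2 z - 1 / (1 + X z ^+ 2)) ^+ 2).
  rewrite /q hat_abs_sq -/(X z); move: (X z) (X1 z) => r r0.
  by field; rewrite gt_eqF.
have err_le k z : (hat (p k).1 z - X z / (1 + X z ^+ 2)) ^+ 2 +
     (hat (p k).2 z - 1 / (1 + X z ^+ 2)) ^+ 2 <= q k z.
  by rewrite q_err ler_peMl ?addr_ge0 ?sqr_ge0// lerDl sqr_ge0.
have mX : measurable_fun setT (X : borel -> R) by exact: measurable_dual_apply.
have minv : measurable_fun setT ((fun z => 1 / (1 + X z ^+ 2)) : borel -> R).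
  have -> : (fun z => 1 / (1 + X z ^+ 2)) = (fun r : R => (1 + r ^+ 2)^-1) \o X.
    by apply/funext => z; rewrite /= div1r.
  apply: measurableT_comp mX; apply: continuous_measurable_fun => r.
  apply: cvgV; first by rewrite gt_eqF// ltr_wpDr// sqr_ge0.
  by apply: cvgD; [exact: cvg_cst|exact: exprn_continuous].
have invle z : 1 / (1 + X z ^+ 2) <= 1.
  by rewrite ler_pdivrMr// mul1r lerDl sqr_ge0.
apply: (measurable_multiplier_set A_mu A_nu).
  apply: (multiplier_square_mean polynomial_functionsM A_mu A_nu
    (a := fun k => hat (p k).2) _ _ Aq) => //;
    [|by eexists| |exact: q0|exact: q0].
    split=> //; exists 1 => z.
    by rewrite ger0_norm// divr_ge0// ltW.
  by move=> k z; rewrite (le_trans _ (err_le k z))// lerDr sqr_ge0.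
apply: (multiplier_square_mean polynomial_functionsM A_mu A_nu
  (a := fun k => hat (p k).1) _ _ Aq) => //;
  [|by eexists| |exact: q0|exact: q0].
  split.
    under eq_fun do rewrite -[X in _ * X]mul1r.
    exact: measurable_funM.
  exists 1 => z; rewrite normrM normfV (gtr0_norm (X1 z)) ler_pdivrMr// mul1r.
  have [X_le|/ltW X_ge] := leP `|X z| 1.
    by rewrite (le_trans X_le)// lerDl sqr_ge0.
  rewrite -[X z ^+ 2]real_normK ?num_real//.
  by rewrite (@le_trans _ _ (`|X z| ^+ 2))// ?lerDr// ler_eXnr.
by move=> k z; rewrite (le_trans _ (err_le k z))// lerDl sqr_ge0.
Qed.

End DeterminedSets.

(** * Cylinder sets and uniqueness *)

Section DeterminedCylinders.
Context (R : realType) (V : lmodType R).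
Local Notation dual := (alg_dual V).
Local Notation borel := (borel_dual V).
Variables (L : {scalar Sym V}) (K : set dual).
Variables (mu nu : {measure set borel -> \bar R}).
Hypotheses (mu_rep : representing_measure K L mu)
  (nu_rep : representing_measure K L nu).
Hypothesis K_measurable : measurable (K : set borel).
Local Notation A := (@polynomial_functions R V).
Local Notation det := (multiplier_set mu nu A).
Local Notation determined := (g_sigma_algebraType det).

Let A_mu a : A a -> mu.-integrable setT (EFin \o a).
Proof. exact: polynomial_functions_integrable mu_rep. Qed.

Let A_nu a : A a -> nu.-integrable setT (EFin \o a).
Proof. exact: polynomial_functions_integrable nu_rep. Qed.

Lemma measurable_determinedE : (measurable : set (set determined)) = det.
Proof. by apply: sigma_algebra_id; exact: sigma_algebra_multiplier_set. Qed.

Lemma determined_subCK (B : set borel) : measurable B -> B `<=` ~` K -> det B.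
Proof.
move=> mB BK; have [_ muK _] := mu_rep; have [_ nuK _] := nu_rep.
have mCK : measurable (~` K : set borel) by exact: measurableC.
by apply: (multiplier_set_null A_mu A_nu) => //; exact: subset_measure0 BK _.
Qed.

Lemma determined_K : det K.
Proof.
have := determined_subCK (measurableC K_measurable) (@subset_refl _ _).
rewrite -measurable_determinedE => /measurableC; rewrite setCK.
by rewrite measurable_determinedE.
Qed.

Lemma measurable_determined_span (x : nat -> V) v :
  (forall j, measurable_fun setT (dual_apply (x j) : determined -> R)) ->
  lin_span x v -> measurable_fun setT (dual_apply v : determined -> R).
Proof.
move=> mx [n [c ->]].
have -> : dual_apply (\sum_(i < n) c i *: x i) =
    (fun z => \sum_(i < n) c i * dual_apply (x i) z).
  apply/funext => z; rewrite /dual_apply linear_sum.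
  by apply: eq_bigr => i _; rewrite scalarZ.
apply: measurable_sum => i.
by apply: measurable_funM => //; exact: measurable_cst.
Qed.

(** On [K] the evaluation at [f] is a pointwise limit of functions measurable
    for the sigma-algebra of determined sets, and every Borel set off [K] is
    null, hence determined. *)
Lemma determined_cylinder (f : V) (v : nat -> V) (U : set R^o) :
  (forall n, measurable_fun setT (dual_apply (v n) : determined -> R)) ->
  (forall z, K z -> dual_apply (v n) z @[n --> \oo] --> dual_apply f z) ->
  open U -> det (dual_apply f @^-1` U).
Proof.
move=> mv vf oU.
have mK : measurable (K : set determined).
  by rewrite measurable_determinedE; exact: determined_K.
have mf : measurable_fun (K : set determined) (dual_apply f : determined -> R).
  apply: (@measurable_fun_cvg _ determined R K
    (fun n => dual_apply (v n) : determined -> R)) => [n|z /vf //].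
  by apply: measurable_funTS; exact: mv.
rewrite -[X in det X]setIT -(setUv K) setIUr -measurable_determinedE.
apply: measurableU.
  by rewrite setIC; apply: mf => //; exact: open_measurable.
rewrite measurable_determinedE; apply: determined_subCK => //.
apply: measurableI; last exact: measurableC.
rewrite -[X in measurable X]setTI; apply: measurable_dual_apply => //.
exact: open_measurable.
Qed.

(** Determined cylinders suffice, although the Borel sets need not be generated
    by cylinders when [V] is large: the determined open sets form a base of the
    topology, and Radon measures are known from such a base. *)
Lemma representing_measure_uniq :
  (forall (f : V) (U : set R^o), open U -> det (dual_apply f @^-1` U)) ->
  forall B : set borel, measurable B -> mu B = nu B.
Proof.
move=> cyl.
have fin (m : {measure set borel -> \bar R}) : representing_measure K L m ->
    (m setT < +oo)%E.
  move=> mrep; have : A (fun=> 1).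
    by exists 1 => //; apply/funext => z; rewrite /hat rmorph1.
  move=> /(polynomial_functions_integrable mrep).
  move=> /(integrable_fin_num measurableT).
  by rewrite /= integral_cst// mul1e ltey_eq => ->.
have [[_ mureg] _ _] := mu_rep; have [[_ nureg] _ _] := nu_rep.
apply: (inner_regular_eq (@alg_dual_hausdorff R V) (D := det)) => //.
- by rewrite -measurable_determinedE; exact: measurable0.
- by rewrite -measurable_determinedE => *; exact: measurableU.
- move=> U z; apply: alg_dual_base => //.
  + by rewrite -measurable_determinedE; exact: measurableT.
  + by rewrite -measurable_determinedE => *; exact: measurableI.
- by move=> W _; exact: (determined_eq mu_rep nu_rep).
- exact: fin.
- exact: fin.
Qed.

End DeterminedCylinders.

Theorem theorem2p1 (R : realType) (V : lmodType R)
    (S : set (V -> R)) (S_seminorm : forall rho, S rho -> is_seminorm rho)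
    (S_separating : is_separating S)
    (tau : Topological V) (tauS : seminorm_topology S tau)
    (V0 : set V) (V0_dense : dense (V0 : set (topo_space tau)))
    (x : nat -> V) (x_basis : is_basis_of x V0)
    (L : {scalar Sym V})
    (L_approx : forall j : nat, exists p : nat -> complexification (Sym V),
       (forall k, complexified (sym_sub V0) (p k)) /\
       (fun k => L (abs_sq (1 - (of_real (sgen (x j)) - imag_unit (Sym V)) * p k)))
         @ \oo --> (0 : R))
    (T : set (V -> R)) (T_sub_S : T `<=` S) (T_countable : countable T) :
  let K := \bigcup_(rho in T) continuous_dual rho in
  (exists mu : {measure set (borel_dual V) -> \bar R}, representing_measure K L mu) ->
  exists mu : {measure set (borel_dual V) -> \bar R},
    representing_measure K L mu /\
    forall nu : {measure set (borel_dual V) -> \bar R},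
      representing_measure K L nu ->
      forall B : set (borel_dual V), measurable B -> nu B = mu B.
Proof.
move=> K [mu mu_rep]; exists mu; split=> // nu nu_rep.
have mK : measurable (K : set (borel_dual V)).
  have [T0|/set0P T0] := eqVneq T set0; first by rewrite /K T0 bigcup_set0.
  have [g Tg] := countable_enumeration T_countable T0.
  rewrite /K Tg bigcup_image; apply: bigcup_measurable => n _.
  apply: measurable_continuous_dual; apply: S_seminorm; apply: T_sub_S.
  by rewrite Tg; exists n.
apply: (representing_measure_uniq nu_rep mu_rep) => f U oU.
have mx j : measurable_fun setT (dual_apply (x j) : g_sigma_algebraType
    (multiplier_set nu mu (@polynomial_functions R V)) -> R).
  have [p [_ Lp]] := L_approx j.
  exact: (measurable_determined_dual_apply nu_rep mu_rep Lp).
have [v V0v vf] := dense_seminorms_cvg S_seminorm tauS V0_dense T_sub_S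
  T_countable f.
apply: (determined_cylinder nu_rep mu_rep mK (v := v)) => // [n|z].
  by apply: (measurable_determined_span mx); case: x_basis => _ ->.
move=> [rho Trho [C C0 zC]].
apply/subr_cvg0/norm_cvg0P.
(* [z] is bounded by a multiple of [rho], a seminorm for which [v] tends to
   [f]. *)
apply: (squeeze_cvgr (f := fun=> 0) (h := fun n => C * rho (f - v n))).
- apply: nearW => n; rewrite normr_ge0/= distrC.
  rewrite -[X in `|X|]/(dual_apply f z - dual_apply (v n) z) -raddfB.
  exact: zC.
- exact: cvg_cst.
- by rewrite -[X in _ --> X](mulr0 C); apply: cvgM; [exact: cvg_cst|exact: vf].
Qed.
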